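(* Let $(A,\cdot)$ be an associative $K$-algebra with enough idempotents, with corresponding family of orthogonal idempotents $\{e_i\}_{i\in I}$, and let $M=\prod_{i,j\in I}e_iAe_j$ be the associated $A$-bimodule. Then the $\mathrm{id}$-matching structures on $(A,\cdot)$ are exactly the products $*$ on $A$ of the form $$a*b=axb\qquad\text{for all }a,b\in A,$$ where $x\in M$.
   Context: All algebras and vector spaces are over a field $K$ and all products are binary and bilinear. An associative algebra $A$ has enough idempotents if there is a family of orthogonal idempotents $\{e_i\}_{i\in I}\subseteq A$ such that $A=\bigoplus_{i\in I}e_iA=\bigoplus_{i\in I}Ae_i$; then $A=\bigoplus_{i,j\in I}e_iAe_j$. For $a\in A$ write $a=\sum_{i,j\in I}a_{ij}$ with $a_{ij}=e_iae_j$. Let $M$ be the $K$-space $\prod_{i,j\in I}e_iAe_j$, whose elements are written $m=\prod_{i,j\in I}m_{ij}$ with $m_{ij}\in e_iAe_j$, and identify $A$ with the subspace of those $m\in M$ for which $\{(i,j)\in I^2\mid m_{ij}\neq0\}$ is finite. $M$ is an $A$-bimodule via $(am)_{ij}=\sum_{k\in I}a_{ik}m_{kj}$ and $(ma)_{ij}=\sum_{k\in I}m_{ik}a_{kj}$ for $a\in A$, $m\in M$, extending the multiplication of $A$, and $amb\in A$ for all $a,b\in A$, $m\in M$. An $\mathrm{id}$-matching structure on $(A,\cdot)$ is an associative bilinear product $*$ on $A$ such that $(a*b)\cdot c=a*(b\cdot c)$ and $(a\cdot b)*c=a\cdot(b*c)$ for all $a,b,c\in A$. *)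

(* Defs.v *)
From HB Require Import structures.
From mathcomp Require Import all_boot all_order all_algebra finmap.
From mathcomp Require Import sesquilinear.
From mathcomp Require Import boolp classical_sets functions cardinality fsbigop.

Set Implicit Arguments.
Unset Strict Implicit.
Unset Printing Implicit Defensive.

Import GRing.Theory.

Local Open Scope classical_set_scope.
Local Open Scope ring_scope.

(* MathComp has no structure for non-unital algebras: an algebra is an         *)
(* [lmodType] with an explicit product.                                        *)
Definition is_algebra (K : fieldType) (A : lmodType K) (mul : A -> A -> A) :=
  bilinear_for *:%R *:%R mul /\ associative mul.

Definition id_matching (K : fieldType) (A : lmodType K)
    (mul star : A -> A -> A) : Prop :=
  [/\ bilinear_for *:%R *:%R star,
      associative star,
      forall a b c, mul (star a b) c = star a (mul b c)
    & forall a b c, star (mul a b) c = mul a (star b c)].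

(* The finite-support condition is part of the data, since \sum_(i \in _) is   *)
(* 0 by convention when the support is infinite.                               *)
Definition internal_direct_sum (A : nmodType) (I : choiceType)
    (U : I -> set A) : Prop :=
  forall a : A, exists! f : I -> A,
    [/\ forall i, U i (f i),
        finite_set [set i | f i <> 0]
      & a = \sum_(i \in [set: I]) f i].

Section EnoughIdempotents.
Context (K : fieldType) (A : lmodType K) (mul : A -> A -> A).
Context (I : choiceType) (e : I -> A).

Definition enough_idempotents : Prop :=
  [/\ forall i, mul (e i) (e i) = e i,
      forall i j, i != j -> mul (e i) (e j) = 0,
      internal_direct_sum (fun i => range (fun a => mul (e i) a))
    & internal_direct_sum (fun i => range (fun a => mul a (e i)))].

Definition corner (i j : I) : set A :=
  range (fun a => mul (mul (e i) a) (e j)).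

Definition prodM : set (I -> I -> A) :=
  [set m | forall i j, corner i j (m i j)].

(* The identification of A with the finitely supported elements of [prodM].    *)
Definition toM (a : A) : I -> I -> A := fun i j => mul (mul (e i) a) (e j).

Definition actl (a : A) (m : I -> I -> A) : I -> I -> A :=
  fun i j => \sum_(k \in [set: I]) mul (toM a i k) (m k j).

Definition actr (m : I -> I -> A) (a : A) : I -> I -> A :=
  fun i j => \sum_(k \in [set: I]) mul (m i k) (toM a k j).

End EnoughIdempotents.

Section Facts.
Context (K : fieldType) (A : lmodType K) (mul : A -> A -> A).
Context (mul_alg : is_algebra mul).
Context (I : choiceType) (e : I -> A) (he : enough_idempotents mul e).

Local Notation "a ** b" := (mul a b) (at level 40, left associativity).
Local Notation M := (prodM mul e).
Local Notation toM := (toM mul e).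
Local Notation actl := (actl mul e).
Local Notation actr := (actr mul e).

Fact amulA : associative mul. Proof. by case: mul_alg. Qed.

Fact amulDl a b c : (a + b) ** c = a ** c + b ** c.
Proof. by case: mul_alg => -[H _] _; have := H c 1 a b; rewrite /= !scale1r. Qed.

Fact amulDr a b c : a ** (b + c) = a ** b + a ** c.
Proof. by case: mul_alg => -[_ H] _; have := H a 1 b c; rewrite /= !scale1r. Qed.

Fact amul0l a : 0 ** a = 0.
Proof. by apply: (@addrI _ (0 ** a)); rewrite -amulDl !addr0. Qed.

Fact amul0r a : a ** 0 = 0.
Proof. by apply: (@addrI _ (a ** 0)); rewrite -amulDr !addr0. Qed.

Fact amul_suml (s : seq I) (F : I -> A) b :
  (\sum_(i <- s) F i) ** b = \sum_(i <- s) F i ** b.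
Proof.
exact: (big_morph (fun a => a ** b) (fun x y => amulDl x y b) (amul0l b)).
Qed.

Fact amul_sumr (s : seq I) (F : I -> A) b :
  b ** (\sum_(i <- s) F i) = \sum_(i <- s) b ** F i.
Proof. exact: (big_morph (fun a => b ** a) (amulDr b) (amul0r b)). Qed.

Fact eee i : e i ** e i = e i.
Proof. by case: he => + _ _ _; exact. Qed.

Fact ee0 i j : i != j -> e i ** e j = 0.
Proof. by case: he => _ + _ _; exact. Qed.

Fact direct_sum_fset (U : I -> set A) a : internal_direct_sum U ->
  exists (F : {fset I}) (f : I -> A),
    (forall i, U i (f i)) /\ a = \sum_(i <- F) f i.
Proof.
move=> /(_ a)[f [[Uf ff ->] _]]; exists (fset_set [set i | f i <> 0]), f.
split=> //; apply: fsbigTE => i.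
by rewrite in_fset_set// notin_setE /= => /contrapT.
Qed.

Fact finite_left a : exists F : {fset I},
  (forall i, i \notin F -> e i ** a = 0) /\ a = \sum_(i <- F) e i ** a.
Proof.
case: he => _ _ /(direct_sum_fset a)[F [f [Uf aE]]] _; exists F.
have ff i j : e i ** f j = if i == j then f j else 0.
  have [b _ <-] := Uf j; rewrite amulA; case: eqVneq => [->|ij].
    by rewrite eee.
  by rewrite ee0// amul0l.
have ea i : e i ** a = if i \in F then f i else 0.
  rewrite aE amul_sumr; case: ifPn => iF.
    rewrite (big_fsetD1 i)//= ff eqxx big_seq big1 ?addr0// => j.
    by rewrite !inE ff eq_sym => /andP[/negPf->].
  rewrite big_seq big1// => j jF; rewrite ff ifN//.
  by apply: contraNneq iF => ->.
split=> [i /negPf iF|]; first by rewrite ea iF.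
by rewrite {1}aE big_seq [RHS]big_seq; apply: eq_bigr => i iF; rewrite ea iF.
Qed.

Fact finite_right a : exists F : {fset I},
  (forall i, i \notin F -> a ** e i = 0) /\ a = \sum_(i <- F) a ** e i.
Proof.
case: he => _ _ _ /(direct_sum_fset a)[F [f [Uf aE]]]; exists F.
have ff i j : f j ** e i = if i == j then f j else 0.
  have [b _ <-] := Uf j; rewrite -amulA; case: eqVneq => [->|ij].
    by rewrite eee.
  by rewrite ee0 1?eq_sym// amul0r.
have ea i : a ** e i = if i \in F then f i else 0.
  rewrite aE amul_suml; case: ifPn => iF.
    rewrite (big_fsetD1 i)//= ff eqxx big_seq big1 ?addr0// => j.
    by rewrite !inE ff eq_sym => /andP[/negPf->].
  rewrite big_seq big1// => j jF; rewrite ff ifN//.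
  by apply: contraNneq iF => ->.
split=> [i /negPf iF|]; first by rewrite ea iF.
by rewrite {1}aE big_seq [RHS]big_seq; apply: eq_bigr => i iF; rewrite ea iF.
Qed.

Fact toM_sum a :
  a = \sum_(i \in [set: I]) \sum_(j \in [set: I]) toM a i j.
Proof.
have eE i : \sum_(j \in [set: I]) toM a i j = e i ** a.
  have [F [aF aE]] := finite_right (e i ** a).
  by rewrite [RHS]aE; exact: fsbigTE.
have [F [aF {1}->]] := finite_left a.
by rewrite -fsbigTE//; apply: eq_fsbigr => i _; rewrite eE.
Qed.

Fact toM_inj : injective toM.
Proof. by move=> a b ab; rewrite (toM_sum a) (toM_sum b) ab. Qed.

Fact cornerl i j a : corner mul e i j a -> e i ** a = a.
Proof. by move=> [b _ <-]; rewrite !amulA eee. Qed.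

Fact cornerr i j a : corner mul e i j a -> a ** e j = a.
Proof. by move=> [b _ <-]; rewrite -amulA eee. Qed.

Fact toM_range m :
  range toM m <-> M m /\ finite_set [set ij | m ij.1 ij.2 <> 0].
Proof.
split=> [[a _ <-]|[mM mfin]].
  split=> [i j|]; first by exists a.
  have [F [aF _]] := finite_left a; have [G [aG _]] := finite_right a.
  apply: (@sub_finite_set _ _ ([set` F] `*` [set` G])); last exact: finite_setX.
  move=> [i j] /= nz; split; apply: contra_notT nz => ijN.
    by rewrite /toM aF// amul0l.
  by rewrite /toM -amulA aG// amul0r.
pose S := fset_set [set ij | m ij.1 ij.2 <> 0].
exists (\sum_(ij <- S) m ij.1 ij.2) => //; apply/funext => i; apply/funext => j.
have em (kl : I * I) : e i ** m kl.1 kl.2 ** e j =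
    if (i, j) == kl then m i j else 0.
  case: kl => k l /=; rewrite xpair_eqE -{1}(cornerl (mM k l)).
  have [<-|ik] := eqVneq i k; last by rewrite amulA ee0// !amul0l.
  rewrite -{1}(cornerr (mM i l)); have [<-|jl] := eqVneq j l.
    by rewrite (cornerr (mM i j)) !(cornerl (mM i j)) (cornerr (mM i j)).
  by rewrite !amulA -(amulA _ (e l)) (ee0 (i := l)) 1?eq_sym// amul0r.
rewrite /toM (big_morph (fun a => e i ** a) (amulDr (e i)) (amul0r (e i))).
rewrite (big_morph (fun a => a ** e j) (fun x y => amulDl x y _) (amul0l _)).
rewrite (eq_bigr (fun kl => if (i, j) == kl then m i j else 0)) //.
have [ijS|ijS] := boolP ((i, j) \in S).
  rewrite (big_fsetD1 (i, j))//= eqxx big_seq big1 ?addr0// => kl.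
  by rewrite !inE eq_sym => /andP[/negPf->].
rewrite big_seq big1 => [|kl klS].
  by move: ijS; rewrite in_fset_set// notin_setE /= => /contrapT.
by rewrite ifN//; apply: contraNneq ijS => ->.
Qed.

Fact actl_toM a b : actl a (toM b) = toM (a ** b).
Proof.
apply/funext => i; apply/funext => j; have [F [aF aE]] := finite_right a.
rewrite /actl (fsbigTE F) => [|k kF]; last first.
  by rewrite /toM -(amulA (e i)) (aF k)// amul0r amul0l.
rewrite /toM {2}aE amul_suml amul_sumr amul_suml; apply: eq_bigr => k _.
by rewrite !amulA -(amulA _ (e k) (e k)) eee.
Qed.

Fact actr_toM a b : actr (toM a) b = toM (a ** b).
Proof.
apply/funext => i; apply/funext => j; have [F [aF aE]] := finite_right a.
rewrite /actr (fsbigTE F) => [|k kF]; last first.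
  by rewrite /toM -(amulA (e i)) (aF k)// amul0r amul0l.
rewrite /toM {2}aE amul_suml amul_sumr amul_suml; apply: eq_bigr => k _.
by rewrite !amulA -(amulA _ (e k) (e k)) eee.
Qed.

Fact sandwich_toM a b m : M m -> range toM (actr (actl a m) b).
Proof.
move=> mM; have [F [aF aE]] := finite_right a.
have [G [bG bE]] := finite_left b.
exists (\sum_(k <- G) (\sum_(l <- F) a ** m l k) ** b) => //.
apply/funext => i; apply/funext => j.
rewrite /actr (fsbigTE G) => [|k kG]; last by rewrite /toM bG// amul0l amul0r.
rewrite /toM amul_sumr amul_suml; apply: eq_bigr => k _.
rewrite /actl (fsbigTE F) => [|l lF]; last first.
  by rewrite /toM -(amulA (e i)) aF// amul0r amul0l.
rewrite !amulA amul_sumr !amul_suml; apply: eq_bigr => l _.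
rewrite /toM -(amulA _ (e l)) (cornerl (mM l k)).
by rewrite -(amulA _ (m l k) (e k)) (cornerr (mM l k)) !amulA.
Qed.

End Facts.

(* Main.v *)
Require Import Defs.
From mathcomp Require Import all_boot all_order all_algebra finmap.
From mathcomp Require Import boolp classical_sets functions cardinality fsbigop.

Set Implicit Arguments.
Unset Strict Implicit.
Unset Printing Implicit Defensive.

(** Put [x i j = e i * e j]. Every [a] is a finite sum of elements [a (e l)] and
every [b] a finite sum of elements [(e k) b], and the two matching identities
let [*] slide past the outer factors:
[(a (e l)) * ((e k) b) = a (e l * e k) b = a (x l k) b].
Summing over [l] and [k] gives [a * b = a x b].

Conversely, let [a * b = a x b] with [x] in [M]. Although [x] itself need not
lie in [A], the product by [x] is locally a product inside [A]: for fixed [a],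
and for [b] ranging over the elements killed on the left by all [e k] with [k]
outside a fixed finite set [G], one has [a * b = u b] for a single [u] in [A]
([locally_mull]), and symmetrically on the other side ([locally_mulr]).
Any finite set of elements has a common such [G], so each axiom of an
id-matching structure reduces to bilinearity and associativity of the product
of [A]. *)

Section Sandwich.
Context (K : fieldType) (A : lmodType K) (mul : A -> A -> A).
Context (mul_alg : is_algebra mul).
Context (I : choiceType) (e : I -> A) (he : enough_idempotents mul e).

Local Open Scope classical_set_scope.
Local Open Scope ring_scope.
Import GRing.Theory.

Local Notation "a ** b" := (mul a b) (at level 40, left associativity).
Local Notation M := (prodM mul e).
Local Notation toM := (toM mul e).
Local Notation actl := (actl mul e).
Local Notation actr := (actr mul e).
Local Notation amulA := (amulA mul_alg).
Local Notation amul0l := (amul0l mul_alg).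
Local Notation amul0r := (amul0r mul_alg).
Local Notation amulDl := (amulDl mul_alg).
Local Notation amulDr := (amulDr mul_alg).
Local Notation amul_suml := (amul_suml mul_alg).
Local Notation amul_sumr := (amul_sumr mul_alg).

Definition lsupp_in (G : {fset I}) (b : A) :=
  forall k, k \notin G -> e k ** b = 0.

Definition rsupp_in (F : {fset I}) (a : A) :=
  forall l, l \notin F -> a ** e l = 0.

Lemma amulZl (c : K) a b : (c *: a) ** b = c *: (a ** b).
Proof.
by case: mul_alg => -[H _] _; have := H b c a 0; rewrite /= amul0l !addr0.
Qed.

Lemma amulZr (c : K) a b : a ** (c *: b) = c *: (a ** b).
Proof.
by case: mul_alg => -[_ H] _; have := H a c b 0; rewrite /= amul0r !addr0.
Qed.

Lemma lsupp_inP b : exists G, lsupp_in G b.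
Proof. by have [G [bG _]] := finite_left mul_alg he b; exists G. Qed.

Lemma rsupp_inP a : exists F, rsupp_in F a.
Proof. by have [F [aF _]] := finite_right mul_alg he a; exists F. Qed.

Lemma lsupp_inM G b c : lsupp_in G b -> lsupp_in G (b ** c).
Proof. by move=> bG k /bG kb; rewrite amulA kb amul0l. Qed.

Lemma rsupp_inM F a c : rsupp_in F a -> rsupp_in F (c ** a).
Proof. by move=> aF l /aF al; rewrite -amulA al amul0r. Qed.

Lemma lsupp_in_comb G (c : K) b b' :
  lsupp_in G b -> lsupp_in G b' -> lsupp_in G (c *: b + b').
Proof.
by move=> bG bG' k kG; rewrite amulDr amulZr bG// bG'// scaler0 addr0.
Qed.

Lemma rsupp_in_comb F (c : K) a a' :
  rsupp_in F a -> rsupp_in F a' -> rsupp_in F (c *: a + a').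
Proof.
by move=> aF aF' l lF; rewrite amulDl amulZl aF// aF'// scaler0 addr0.
Qed.

Lemma lsupp_inP2 b b' : exists G, lsupp_in G b /\ lsupp_in G b'.
Proof.
have [G bG] := lsupp_inP b; have [H bH] := lsupp_inP b'.
exists (G `|` H)%fset; split=> k; rewrite in_fsetU negb_or => /andP[kG kH].
  exact: bG.
exact: bH.
Qed.

Lemma rsupp_inP2 a a' : exists F, rsupp_in F a /\ rsupp_in F a'.
Proof.
have [F aF] := rsupp_inP a; have [H aH] := rsupp_inP a'.
exists (F `|` H)%fset; split=> l; rewrite in_fsetU negb_or => /andP[lF lH].
  exact: aF.
exact: aH.
Qed.

(** The (possibly infinite) matrix product [a x b] only meets the rows of [x]
indexed by [F] and its columns indexed by [G], so it is a finite sum in [A]. The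
sets [F] and [G] may be any that are large enough: this freedom is what makes the
sum comparable for different [a] and [b]. *)
Lemma sandwich_sum x F G a b : M x -> rsupp_in F a -> lsupp_in G b ->
  actr (actl a x) b = toM (\sum_(k <- G) \sum_(l <- F) a ** x l k ** b).
Proof.
move=> xM aF bG; apply/funext => i; apply/funext => j.
rewrite /actr (fsbigTE G) => [|k kG]; last by rewrite /toM bG// amul0l amul0r.
rewrite /toM amul_sumr amul_suml; apply: eq_bigr => k _.
rewrite /actl (fsbigTE F) => [|l lF]; last first.
  by rewrite /toM -(amulA (e i)) aF// amul0r amul0l.
rewrite amul_sumr !amul_suml; apply: eq_bigr => l _.
rewrite /toM -(amulA _ (e l)) (cornerl mul_alg he (xM l k)).
rewrite !amulA -(amulA _ (x l k) (e k)).
by rewrite (cornerr mul_alg he (xM l k)).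
Qed.

Section FromElement.
Context (star : A -> A -> A) (x : I -> I -> A) (xM : M x).
Context (starE : forall a b, toM (star a b) = actr (actl a x) b).

Lemma star_sum F G a b : rsupp_in F a -> lsupp_in G b ->
  star a b = \sum_(k <- G) \sum_(l <- F) a ** x l k ** b.
Proof.
move=> aF bG; apply: (toM_inj mul_alg he).
by rewrite starE; exact: sandwich_sum.
Qed.

Lemma locally_mull a G : exists u, forall b, lsupp_in G b -> star a b = u ** b.
Proof.
have [F aF] := rsupp_inP a.
exists (\sum_(k <- G) \sum_(l <- F) a ** x l k) => b bG.
rewrite (star_sum aF bG) amul_suml; apply: eq_bigr => k _.
by rewrite amul_suml.
Qed.

Lemma locally_mulr b F : exists v, forall a, rsupp_in F a -> star a b = a ** v.
Proof.
have [G bG] := lsupp_inP b.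
exists (\sum_(k <- G) \sum_(l <- F) x l k ** b) => a aF.
rewrite (star_sum aF bG) amul_sumr; apply: eq_bigr => k _.
by rewrite amul_sumr; apply: eq_bigr => l _; rewrite amulA.
Qed.

Lemma star_mulr a b c : star a b ** c = star a (b ** c).
Proof.
have [G bG] := lsupp_inP b; have [u uE] := locally_mull a G.
by rewrite !uE ?amulA//; exact: lsupp_inM.
Qed.

Lemma star_mull a b c : star (a ** b) c = a ** star b c.
Proof.
have [F bF] := rsupp_inP b; have [v vE] := locally_mulr c F.
by rewrite !vE ?amulA//; exact: rsupp_inM.
Qed.

Lemma star_linearr a (c : K) b b' :
  star a (c *: b + b') = c *: star a b + star a b'.
Proof.
have [G [bG bG']] := lsupp_inP2 b b'; have [u uE] := locally_mull a G.
by rewrite !uE ?amulDr ?amulZr//; exact: lsupp_in_comb.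
Qed.

Lemma star_linearl b (c : K) a a' :
  star (c *: a + a') b = c *: star a b + star a' b.
Proof.
have [F [aF aF']] := rsupp_inP2 a a'; have [v vE] := locally_mulr b F.
by rewrite !vE ?amulDl ?amulZl//; exact: rsupp_in_comb.
Qed.

(** Replacing [a * _] by [u _] turns associativity into the second matching
identity; that identity also shows that the same [u] serves for [b * c],
because [e k (b * c) = (e k b) * c]. *)
Lemma star_assoc : associative star.
Proof.
move=> a b c; have [G bG] := lsupp_inP b; have [u uE] := locally_mull a G.
have star0 : star 0 c = 0 by rewrite -{1}(amul0l 0) star_mull amul0l.
rewrite (uE b)// star_mull uE// => k kG.
by rewrite -star_mull bG.
Qed.

Lemma id_matching_of_sandwich : id_matching mul star.
Proof.
split.
- by split=> [b|a] c y z; [exact: star_linearl|exact: star_linearr].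
- exact: star_assoc.
- exact: star_mulr.
- exact: star_mull.
Qed.

End FromElement.

Lemma sandwich_of_id_matching star : id_matching mul star ->
  exists2 x, M x & forall a b, toM (star a b) = actr (actl a x) b.
Proof.
move=> [starB starA starr starl].
have star_alg : is_algebra star by [].
have xM : M (fun i j => star (e i) (e j)).
  move=> i j; exists (star (e i) (e j)) => //.
  by rewrite -starl starr !(eee he).
exists (fun i j => star (e i) (e j)) => // a b.
have [F [aF aE]] := finite_right mul_alg he a.
have [G [bG bE]] := finite_left mul_alg he b.
rewrite (sandwich_sum xM aF bG); congr toM.
rewrite {1}bE (Defs.amul_sumr star_alg); apply: eq_bigr => k _.
rewrite {1}aE (Defs.amul_suml star_alg); apply: eq_bigr => l _.
by rewrite starl -starr amulA.
Qed.

End Sandwich.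

Theorem proposition3p18 (K : fieldType) (A : lmodType K)
    (mul : A -> A -> A) (mul_alg : is_algebra mul)
    (I : choiceType) (e : I -> A) (he : enough_idempotents mul e)
    (star : A -> A -> A) :
  id_matching mul star <->
  exists2 x : I -> I -> A, prodM mul e x &
    forall a b : A,
      toM mul e (star a b) = actr mul e (actl mul e a x) b.
Proof.
split; first exact: sandwich_of_id_matching.
by move=> [x xM starE]; exact: (id_matching_of_sandwich mul_alg he xM starE).
Qed.
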